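(* Let $k\ge2$. With $\mathcal E_{k,i}(N)$ ($0<i\le k$) and $\Gamma_{k,i}(N)$ ($0\le i<k$) the generating functions defined below, for all $N\ge0$: $$\mathcal{E}_{k,i}(N) = (ab)^N (-1/a,-1/b;q)_N q^N \sum_{n=-N}^N \frac{(-1)^nq^{n((2k-1)n+3)/2+(k-i-1)n}}{(q;q)_{N-n}(q;q)_{N+n}},\qquad \Gamma_{k,i}(N) = (ab)^N (-1/a,-1/b;q)_N \sum_{n=-N}^{N-1} \frac{(-1)^nq^{n((2k-1)n+3)/2+(k-i-2)n}}{(q;q)_{N-n-1}(q;q)_{N+n}}.$$
   Context: $(a;q)_n=\prod_{j=0}^{n-1}(1-aq^j)$, $(a,b;q)_n=(a;q)_n(b;q)_n$. Generalized Bressoud–Burge lattice paths: paths in the first quadrant starting on the $y$-axis and ending on the $x$-axis, with steps NE $(x,y)\to(x+1,y+1)$, SE $(x,y)\to(x+1,y-1)$, S $(x,y)\to(x,y-1)$, SW $(x,y)\to(x-1,y-1)$, E $(x,0)\to(x+1,0)$ (only at height 0), where S and SW steps may only occur immediately after an NE step (the path ends at its first arrival on the $x$-axis after its last peak, or at its first arrival on the $x$-axis if it has no peak). A peak is a vertex preceded by NE and followed by S (labelled $a$ or $b$: an $a$-peak or $b$-peak), by SW (an $ab$-peak), or by SE (a $1$-peak). Marked by $a$: $a$-peaks and $ab$-peaks; marked by $b$: $b$-peaks and $ab$-peaks. Major index: sum of the $x$-coordinates of the peaks. Odd $(k,i)$-conditions: start at $(0,k-i)$ and height always $<k$. $\mathcal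 E_{k,i}(N)=\sum a^sb^tq^n$ over paths with exactly $N$ peaks satisfying the odd $(k,i)$-conditions, $s,t,n$ being the numbers of peaks marked by $a$, by $b$, and the major index. $\Gamma_{k,i}(N)$ is the same kind of generating function for the objects obtained from the paths counted by $\mathcal E_{k,i+1}(N)$ that begin with an NE step, by deleting this NE step and shifting the rest one unit to the left. *)

(* Defs.v *)
From HB Require Import structures.
From mathcomp Require Import all_boot all_order all_algebra.
From mathcomp Require Import all_classical.

Set Implicit Arguments.
Unset Strict Implicit.
Unset Printing Implicit Defensive.

Import GRing.Theory Num.Theory.

Local Open Scope ring_scope.

(* Formal power series in q; the product is the Cauchy product. *)

Record fps (R : Type) := Fps { fps_coef : nat -> R }.
Coercion fps_coef : fps >-> Funclass.

HB.instance Definition _ (R : Type) := gen_eqMixin (fps R).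
HB.instance Definition _ (R : Type) := gen_choiceMixin (fps R).

Lemma fpsP (R : Type) (f g : fps R) : f =1 g -> f = g.
Proof. by case: f g => [f] [g] /= /funext ->. Qed.

Section FpsRing.
Variable R : comNzRingType.
Implicit Types f g h : fps R.

Definition fps_add f g : fps R := Fps (fun n => f n + g n).
Definition fps_opp f : fps R := Fps (fun n => - f n).
Definition fps_mul f g : fps R :=
  Fps (fun n => \sum_(i < n.+1) f i * g (n - i)%N).
Definition fpsC (c : R) : fps R := Fps (fun n => if n == 0%N then c else 0).
Definition fpsX : fps R := Fps (fun n => if n == 1%N then 1 else 0).

Fact fps_addA : associative fps_add.
Proof. by move=> f g h; apply: fpsP => n /=; rewrite addrA. Qed.
Fact fps_addC : commutative fps_add.
Proof. by move=> f g; apply: fpsP => n /=; rewrite addrC. Qed.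
Fact fps_add0 : left_id (fpsC 0) fps_add.
Proof. by move=> f; apply: fpsP => n /=; rewrite if_same add0r. Qed.
Fact fps_addN : left_inverse (fpsC 0) fps_opp fps_add.
Proof. by move=> f; apply: fpsP => n /=; rewrite if_same addNr. Qed.

HB.instance Definition _ :=
  GRing.isZmodule.Build (fps R) fps_addA fps_addC fps_add0 fps_addN.

Let trunc m f : {poly R} := \poly_(i < m) f i.

Let fps_mul_trunc m f g n : (n < m)%N ->
  fps_mul f g n = (trunc m f * trunc m g)`_n.
Proof.
move=> ltnm; rewrite coefM /=; apply: eq_bigr => i _.
rewrite !coef_poly (leq_ltn_trans (leq_subr _ _) ltnm).
by rewrite (leq_ltn_trans _ ltnm) // -ltnS.
Qed.

Fact fps_mulC : commutative fps_mul.
Proof.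
by move=> f g; apply: fpsP => n; rewrite !(@fps_mul_trunc n.+1) // mulrC.
Qed.

Fact fps_mulA : associative fps_mul.
Proof.
move=> f g h; apply: fpsP => n; pose T := trunc n.+1.
have Tl (u v : fps R) w : (T (fps_mul u v) * w)`_n = (T u * T v * w)`_n.
  rewrite [LHS]coefM [RHS]coefM; apply: eq_bigr => i _; congr (_ * _).
  by rewrite coef_poly ltn_ord (@fps_mul_trunc n.+1).
by rewrite !(@fps_mul_trunc n.+1) // mulrC -/T !Tl mulrC mulrA.
Qed.

Fact fps_mul1 : left_id (fpsC 1) fps_mul.
Proof.
move=> f; apply: fpsP => n /=; rewrite big_ord_recl /= mul1r subn0 big1 ?addr0//.
by move=> i _; rewrite mul0r.
Qed.

Fact fps_mulDl : left_distributive fps_mul fps_add.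
Proof.
move=> f g h; apply: fpsP => n /=; rewrite -big_split /=.
by apply: eq_bigr => i _; rewrite mulrDl.
Qed.

Fact fps_oner_neq0 : fpsC 1 != 0.
Proof. by apply/eqP => /(congr1 (fun f : fps R => f 0%N)) /= /eqP; rewrite oner_eq0. Qed.

HB.instance Definition _ := GRing.Zmodule_isComNzRing.Build (fps R)
  fps_mulA fps_mulC fps_mul1 fps_mulDl fps_oner_neq0.

Definition fps_unit f := `[< exists g, g * f = 1 >].
Definition fps_inv f :=
  if pselect (exists g, g * f = 1) is left e then projT1 (cid e) else f.

Fact fps_mulV : {in fps_unit, left_inverse 1 fps_inv *%R}.
Proof.
move=> f /asboolP ef; rewrite /fps_inv.
by case: pselect => // e; case: cid.
Qed.
Fact fps_unitPl f g : g * f = 1 -> fps_unit f.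
Proof. by move=> gf; apply/asboolP; exists g. Qed.
Fact fps_invr_out : {in [predC fps_unit], fps_inv =1 id}.
Proof. by move=> f /asboolPn nf; rewrite /fps_inv; case: pselect. Qed.

HB.instance Definition _ := GRing.ComNzRing_hasMulInverse.Build (fps R)
  fps_mulV fps_unitPl fps_invr_out.

End FpsRing.

Section FpsDomain.
Variable R : idomainType.
Implicit Types f g : fps R.

Let fps_neq0 f : f != 0 ->
  exists2 m, f m != 0 & forall i, (i < m)%N -> f i = 0.
Proof.
move=> f0; have ex : exists m, f m != 0.
  apply: contrapT => /forallNP nf; case/eqP: f0; apply: fpsP => n /=.
  by rewrite if_same; apply/eqP/negbNE/negP/nf.
exists (ex_minn ex); first by case: ex_minnP.
case: ex_minnP => m _ mmin i ltim; apply/eqP/negbNE/negP => /mmin.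
by rewrite leqNgt ltim.
Qed.

Fact fps_mulf_eq0 f g : f * g = 0 -> (f == 0) || (g == 0).
Proof.
move=> fg0; apply/norP => -[/fps_neq0[m fm f0] /fps_neq0[p gp g0]].
have /= := congr1 (fun h : fps R => h (m + p)%N) fg0; rewrite if_same.
have ltm : (m < (m + p).+1)%N by rewrite ltnS leq_addr.
rewrite (bigD1 (Ordinal ltm)) //= addKn big1 ?addr0 => [/eqP|i].
  by rewrite mulf_eq0 (negPf fm) (negPf gp).
rewrite -val_eqE /= neq_ltn => /orP[/f0->|ltmi]; first by rewrite mul0r.
rewrite (g0 (m + p - i)%N) ?mulr0 //.
by rewrite ltn_subLR ?ltn_add2r // -ltnS ltn_ord.
Qed.

HB.instance Definition _ :=
  GRing.ComUnitRing_isIntegral.Build (fps R) fps_mulf_eq0.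

End FpsDomain.

(* For a field F, the fraction field of F[[q]] is the field F((q)) of formal
   Laurent series, where q can be raised to any integer power and every
   nonzero power series can be inverted. *)
Notation laurent F := {fraction (fps F)}.
Definition laurentC (F : fieldType) (c : F) : laurent F := tofrac (fpsC c).
Definition laurentX (F : fieldType) : laurent F := tofrac (fpsX F).

Definition qpoch (K : nzRingType) (x q : K) (n : nat) : K :=
  \prod_(j < n) (1 - x * q ^+ j).

Definition qpoch2 (K : nzRingType) (x y q : K) (n : nat) : K :=
  qpoch x q n * qpoch y q n.

(* The integers lo, lo + 1, ..., hi (none if hi < lo). *)
Definition int_range (lo hi : int) : seq int :=
  if lo <= hi then [seq lo + j%:Z | j <- iota 0 (absz (hi - lo)%R).+1] else [::].

(* Sa and Sb are the South step taken from an a-peak and from a b-peak. *)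
Inductive step := NE | SE | Sa | Sb | SW | E.

Definition step_code (s : step) : nat :=
  match s with NE => 0 | SE => 1 | Sa => 2 | Sb => 3 | SW => 4 | E => 5 end.
Definition step_decode (i : nat) : step := nth E [:: NE; SE; Sa; Sb; SW] i.
Lemma step_codeK : cancel step_code step_decode.
Proof. by case. Qed.
HB.instance Definition _ := Countable.copy step (can_type step_codeK).
Lemma step_enumP : Finite.axiom [:: NE; SE; Sa; Sb; SW; E].
Proof. by case. Qed.
HB.instance Definition _ := isFinite.Build step step_enumP.

Definition point := (int * int)%type.

Definition move (v : point) (s : step) : point :=
  match s with
  | NE => (v.1 + 1, v.2 + 1)
  | SE => (v.1 + 1, v.2 - 1)
  | Sa | Sb => (v.1, v.2 - 1)
  | SW => (v.1 - 1, v.2 - 1)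
  | E => (v.1 + 1, v.2)
  end.

(* A path is given by its starting point and its sequence p of steps; its
   vertices are numbered from 0 to size p, and step number j goes from vertex
   j to vertex j + 1. *)
Definition vertex (v0 : point) (p : seq step) (j : nat) : point :=
  foldl move v0 (take j p).

(* The step arriving at vertex j; prev is the step regarded as arriving at the
   starting point: None for a genuine path, Some NE for a path whose initial
   NE step has been deleted. *)
Definition step_before (prev : option step) (p : seq step) (j : nat) :
    option step :=
  if j is j'.+1 then onth p j' else prev.

Definition step_after (p : seq step) (j : nat) : option step := onth p j.

Definition is_peak (prev : option step) (p : seq step) (j : nat) : bool :=
  (step_before prev p j == Some NE) &&
  (step_after p j \in [:: Some Sa; Some Sb; Some SW; Some SE]).

Definition peaks (prev : option step) (p : seq step) : seq nat :=
  [seq j <- iota 0 (size p) | is_peak prev p j].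

Definition a_marks (prev : option step) (p : seq step) : nat :=
  count (fun j => step_after p j \in [:: Some Sa; Some SW]) (peaks prev p).

Definition b_marks (prev : option step) (p : seq step) : nat :=
  count (fun j => step_after p j \in [:: Some Sb; Some SW]) (peaks prev p).

Definition major (prev : option step) (v0 : point) (p : seq step) : int :=
  \sum_(j <- peaks prev p) (vertex v0 p j).1.

(* last 0 (peaks None p) is the number of the last peak, or 0, the starting
   point, if there is no peak; the last clause says that the end of the path is
   its first vertex on the x-axis from there on. *)
Definition lattice_path (v0 : point) (p : seq step) : Prop :=
  [/\ v0.1 = 0,
      forall j, (j <= size p)%N ->
        0 <= (vertex v0 p j).1 /\ 0 <= (vertex v0 p j).2,
      forall j, step_after p j = Some E -> (vertex v0 p j).2 = 0,
      forall j, step_after p j \in [:: Some Sa; Some Sb; Some SW] ->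
        step_before None p j = Some NE &
      (vertex v0 p (size p)).2 = 0 /\
      forall j, (last 0 (peaks None p) <= j < size p)%N ->
        (vertex v0 p j).2 <> 0].

Definition odd_start (k i : nat) : point := (0, k%:Z - i%:Z).

Definition odd_conditions (k i : nat) (v0 : point) (p : seq step) : Prop :=
  v0 = odd_start k i /\
  forall j, (j <= size p)%N -> (vertex v0 p j).2 < k%:Z.

Definition odd_paths (k i N : nat) : set (seq step) :=
  [set p | [/\ lattice_path (odd_start k i) p,
               odd_conditions k i (odd_start k i) p &
               size (peaks None p) = N]].

(* The coefficient of q^n is the sum of a^s b^t over the elements of P with
   major index n. Its set of summands is finite for the two families P used
   below, and their major indices are nonnegative. *)
Definition genfun (F : fieldType) (a b : F) (prev : option step) (v0 : point)
    (P : set (seq step)) : fps F :=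
  Fps (fun n : nat =>
    \sum_(p \in P `&` [set p | major prev v0 p = n%:Z])
      a ^+ a_marks prev p * b ^+ b_marks prev p).

Definition Epaths (F : fieldType) (a b : F) (k i N : nat) : fps F :=
  genfun a b None (odd_start k i) (odd_paths k i N).

(* A path NE :: p from (0, k - i - 1) becomes p, now started at (0, k - i). Its
   peaks are those of NE :: p: the starting point is one of them if it was a
   peak before the deletion. *)
Definition Gpaths (F : fieldType) (a b : F) (k i N : nat) : fps F :=
  genfun a b (Some NE) (odd_start k i) [set p | odd_paths k i.+1 N (NE :: p)].

(* Main.v *)
Require Import Defs.
From mathcomp Require Import all_boot all_order all_algebra.
From mathcomp Require Import all_classical.
From mathcomp Require Import zify ring.

(* Split a path after its first step. With y = k - i the starting height, write
   E(y,N) and G(y,N) for the two generating functions. Translating the rest of a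
   path with N peaks horizontally by d multiplies its weight by q^(dN), so that
     E(y,N) = q^N (G(y+1,N) + E(y-1,N))   for y > 0,
     E(0,N) = q^N (G(1,N) + E(0,N)),
     q^N G(y+1,N+1) = q^(2N+1) G(y+2,N+1) + (a+q^N)(b+q^N) E(y,N),
   the last product collecting the four kinds of peak. Together with G(k,N) = 0,
   E(y,0) = 1 and G(y,0) = 0 these equations determine E and G. The right-hand
   sides of the theorem satisfy them too: termwise, because
   (1 - q^m) / (q;q)_m = 1 / (q;q)_(m-1), and at the two extreme heights because
   of the symmetries n -> -n and n -> -1-n of the summands. *)

Set Implicit Arguments.
Unset Strict Implicit.
Unset Printing Implicit Defensive.

Import Order.TTheory GRing.Theory Num.Theory.

Local Open Scope ring_scope.

(** * Recursive description of paths and their statistics *)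

Definition descends (s : step) : bool := s \in [:: Sa; Sb; SW; SE].

(* In the recursive statistics below, [up] tells whether the step arriving at
   the current vertex is NE. *)
Fixpoint peak_count (up : bool) (p : seq step) : nat :=
  if p is s :: p' then ((up && descends s) + peak_count (s == NE) p')%N else 0%N.

Fixpoint major_from (up : bool) (x : int) (p : seq step) : int :=
  if p is s :: p' then
    (if up && descends s then x else 0) +
    major_from (s == NE) (Defs.move (x, 0) s).1 p'
  else 0.

Definition step_weight (F : fieldType) (a b : F) (s : step) : F :=
  match s with Sa => a | Sb => b | SW => a * b | _ => 1 end.

Fixpoint weight (F : fieldType) (a b : F) (up : bool) (p : seq step) : F :=
  if p is s :: p' then
    (if up then step_weight a b s else 1) * weight a b (s == NE) p'
  else 1.

Lemma is_peak0 prev s p :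
  is_peak prev (s :: p) 0 = (prev == Some NE) && descends s.
Proof. by rewrite /is_peak /= /descends; case: s. Qed.

Lemma peaks_cons prev s p :
  peaks prev (s :: p) =
  (if (prev == Some NE) && descends s then [:: 0%N] else [::]) ++
  map S (peaks (Some s) p).
Proof.
rewrite /peaks [size _]/= [iota _ _]/= [LHS]/= is_peak0 (iotaDl 1 0).
rewrite filter_map.
have -> : seq.filter (preim (addn 1) (is_peak prev (s :: p))) (iota 0 (size p)) =
    seq.filter (is_peak (Some s) p) (iota 0 (size p)).
  by apply: eq_filter; case.
by case: ifP.
Qed.

Lemma size_peaks prev p : size (peaks prev p) = peak_count (prev == Some NE) p.
Proof.
elim: p prev => [//|s p IH] prev.
by rewrite peaks_cons size_cat size_map IH /=; case: ifP.
Qed.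

Lemma major_fromE prev v p : major prev v p = major_from (prev == Some NE) v.1 p.
Proof.
elim: p prev v => [|s p IH] prev v; first by rewrite /major big_nil.
rewrite /major peaks_cons big_cat big_map /=; congr (_ + _).
  by case: ifP => _; rewrite ?big_seq1 ?big_nil.
by rewrite -[LHS]/(major (Some s) (Defs.move v s) p) IH; case: s; case: v.
Qed.

Lemma marks_weight (F : fieldType) (a b : F) prev p :
  a ^+ a_marks prev p * b ^+ b_marks prev p = weight a b (prev == Some NE) p.
Proof.
elim: p prev => [|s p IH] prev; first by rewrite mulr1.
rewrite /a_marks /b_marks peaks_cons !count_cat !exprD mulrACA !count_map /=.
rewrite -[X in _ * X]/(a ^+ a_marks (Some s) p * b ^+ b_marks (Some s) p) IH.
congr (_ * _); case: (prev == Some NE); last by rewrite mulr1.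
by case: s => /=; rewrite ?expr0 ?expr1 ?mulr1 ?mul1r.
Qed.

(** The [E] clause demands a later peak because a path stops at its first arrival on the axis after
    its last peak; an [NE] step from the axis brings such a peak by itself ([walk_up_peak]).
    Abscissas do not appear: their nonnegativity follows from the rest ([vertex_x_ge0]). *)
Fixpoint walk (k : nat) (up : bool) (y : nat) (p : seq step) : bool :=
  match p with
  | [::] => y == 0%N
  | NE :: p' => (y < k)%N && walk k true y.+1 p'
  | SE :: p' => (0 < y < k)%N && walk k false y.-1 p'
  | E :: p' => [&& y == 0%N, (0 < peak_count false p')%N & walk k false 0 p']
  | _ :: p' => [&& up, (0 < y < k)%N & walk k false y.-1 p']
  end.

(** A run of [NE] steps cannot be the end of the path, and as [E] is impossible above the axis, a
    descending step follows it. *)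
Lemma walk_up_peak k y p : walk k true y.+1 p -> (0 < peak_count true p)%N.
Proof. by elim: p y => [//|[] p IH] y //= /andP[_ /IH]. Qed.

(** A form of the path conditions that passes to tails: any start, any preceding step, no condition
    on abscissas. *)
Definition raw_path (k : nat) (prev : option step) (v : Defs.point) (p : seq step) :
    Prop :=
  [/\ forall j, (j <= size p)%N -> 0 <= (vertex v p j).2 < k%:Z,
      forall j, step_after p j = Some E -> (vertex v p j).2 = 0,
      forall j, step_after p j \in [:: Some Sa; Some Sb; Some SW] ->
        step_before prev p j = Some NE,
      (vertex v p (size p)).2 = 0 &
      forall j, (last 0 (peaks prev p) <= j < size p)%N ->
        (vertex v p j).2 <> 0].

Lemma raw_path_nil k prev v : (0 < k)%N -> raw_path k prev v [::] <-> v.2 = 0.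
Proof.
move=> k0; split=> [[]//|v0]; split=> // j; rewrite /vertex /=.
  by move=> _; rewrite v0; lia.
by case: j.
Qed.

(** With the default 0, a peak at vertex 0 and the absence of peaks look alike, so only the peaks of
    the tail decide. *)
Lemma last_peaks_cons prev s p :
  last 0%N (peaks prev (s :: p)) =
  if peaks (Some s) p == [::] then 0%N else (last 0%N (peaks (Some s) p)).+1.
Proof.
rewrite peaks_cons; case: (peaks (Some s) p) => [|n l] /=; first by case: ifP.
by rewrite last_cat /= last_map.
Qed.

Lemma raw_path_cons k prev v s p :
  raw_path k prev v (s :: p) <->
  [/\ 0 <= v.2 < k%:Z, s = E -> v.2 = 0,
      s \in [:: Sa; Sb; SW] -> prev = Some NE,
      v.2 = 0 -> (0 < peak_count (s == NE) p)%N &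
      raw_path k (Some s) (Defs.move v s) p].
Proof.
have pc0 : (0 < peak_count (s == NE) p)%N = (peaks (Some s) p != [::]).
  by rewrite -[s == NE]/(Some s == Some NE) -size_peaks; case: peaks.
rewrite pc0 /raw_path last_peaks_cons; split.
  case=> H1 H2 H3 H4 H5; split=> //.
  - exact: (H1 0%N).
  - by move=> sE; apply: (H2 0%N); rewrite sE.
  - by move=> sS; apply: (H3 0%N); move: sS; case: (s).
  - move=> v0; apply/eqP => pe; apply: (H5 0%N) => //; first by rewrite pe.
  - split=> [j|j|j||j] //.
    + exact: (H1 j.+1).
    + exact: (H2 j.+1).
    + by move=> /(H3 j.+1); case: j.
    + move=> jp; apply: (H5 j.+1); case: ifP jp => // /eqP ->.
      by rewrite ltnS.
case=> C1 C2 C3 C4 [H1 H2 H3 H4 H5]; split=> //.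
- by case=> [_|j] //; apply: H1.
- by case=> [[]|j] //; apply: H2.
- case=> [sS|j]; first by apply: C3; move: sS; case: (s).
  by move=> /H3; case: j.
- case=> [|j].
    by case: ifP => // /eqP pe _ v0; move: (C4 v0); rewrite pe.
  move=> jp; apply: H5; case: ifP jp => [/eqP ->|_] //.
Qed.

Lemma raw_path_walk k prev (v : Defs.point) (y : nat) p : (0 < k)%N -> v.2 = y%:Z ->
  raw_path k prev v p <-> walk k (prev == Some NE) y p.
Proof.
move=> k0; elim: p prev v y => [|s p IH] prev v y vy.
  by rewrite raw_path_nil // vy /=; split=> [[->]|/eqP ->].
rewrite raw_path_cons vy; case: v vy => x _ /= ->.
have step z : (Defs.move (x, y%:Z) s).2 = z%:Z ->
    raw_path k (Some s) (Defs.move (x, y%:Z) s) p <-> walk k (s == NE) z p.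
  by move=> ?; apply: IH.
have raw0 : raw_path k (Some s) (Defs.move (x, y%:Z) s) p ->
    0 <= (Defs.move (x, y%:Z) s).2 by case=> /(_ 0%N isT); rewrite /vertex take0 => /andP[].
have down : (0 < y)%N -> y%:Z - 1 = y.-1%:Z by lia.
have up1 : y%:Z + 1 = y.+1%:Z by lia.
case: s step raw0 => /= step raw0.
- split=> [[yk _ _ _ /(step _ up1) ->]|/andP[yk w]]; first by rewrite andbT; lia.
  split=> //; [by move=> _; apply: walk_up_peak w|exact/(step _ up1)].
- split=> [[yk _ _ _ r]|/andP[yk w]].
    have y0 : (0 < y)%N by have := raw0 r; lia.
    by move/(step _ (down y0)): r => ->; rewrite andbT; lia.
  by split=> //; [lia|lia|apply/(step y.-1) => //; lia].
- split=> [[yk _ ->// _ r]|/and3P[/eqP ? yk w]].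
    have y0 : (0 < y)%N by have := raw0 r; lia.
    by move/(step _ (down y0)): r => ->; rewrite eqxx andbT y0; lia.
  by split=> //; [lia|lia|apply/(step y.-1) => //; lia].
- split=> [[yk _ ->// _ r]|/and3P[/eqP ? yk w]].
    have y0 : (0 < y)%N by have := raw0 r; lia.
    by move/(step _ (down y0)): r => ->; rewrite eqxx andbT y0; lia.
  by split=> //; [lia|lia|apply/(step y.-1) => //; lia].
- split=> [[yk _ ->// _ r]|/and3P[/eqP ? yk w]].
    have y0 : (0 < y)%N by have := raw0 r; lia.
    by move/(step _ (down y0)): r => ->; rewrite eqxx andbT y0; lia.
  by split=> //; [lia|lia|apply/(step y.-1) => //; lia].
- split=> [[_ /(_ erefl) [y0] _ pc r]|/and3P[/eqP y0 pc w]].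
    move: pc r; rewrite y0 in step *; move=> /(_ erefl) ->.
    by move/(step 0%N erefl) ->.
  split=> //; [lia|by rewrite y0|by apply/(step 0%N) => //; rewrite y0].
Qed.

(** Only [SW] moves left, and the [NE] step before it has moved right. The invariant is abscissa at
    least 1 after [NE], at least 0 otherwise. *)
Lemma vertex_x_ge0 prev v p :
  (forall j, step_after p j \in [:: Some Sa; Some Sb; Some SW] ->
     step_before prev p j = Some NE) ->
  (prev == Some NE)%:R <= v.1 ->
  forall j, (j <= size p)%N -> 0 <= (vertex v p j).1.
Proof.
elim: p prev v => [|s p IH] prev v H xv j.
  by rewrite leqn0 => /eqP ->; apply: le_trans xv.
case: j => [_|j]; first by apply: le_trans xv.
rewrite /= ltnS => jp; apply: (IH (Some s)) => //.
  by move=> i /(H i.+1); case: i.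
have := H 0%N; case: s {H jp} => /= H; move: xv; case: eqP => //=; try lia.
by move=> pn; rewrite H in pn.
Qed.

Lemma odd_pathsE k i N p : (0 < k)%N -> (i <= k)%N ->
  odd_paths k i N p <-> walk k false (k - i) p /\ peak_count false p = N.
Proof.
move=> k0 ik; have v2 : (odd_start k i).2 = (k - i)%N%:Z by rewrite /=; lia.
rewrite -(raw_path_walk None p k0 v2) -[peak_count _ _](size_peaks None).
split=> [[[_ H1 H2 H3 [H4 H5]] [_ H6] pN]|[[H1 H2 H3 H4 H5] pN]].
  by split=> //; split=> // j jp; rewrite H6 // andbT; case: (H1 j jp).
split=> //; split=> // j jp; last by case/andP: (H1 j jp).
split; last by case/andP: (H1 j jp).
exact: vertex_x_ge0 H3 _ _ jp.
Qed.

Local Open Scope classical_set_scope.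

(** * Translation and sign of the major index *)

Lemma major_from_shift up x d p :
  major_from up (x + d) p = major_from up x p + (peak_count up p)%:Z * d.
Proof.
elim: p up x => [|s p IH] up x /=; first by rewrite mul0r addr0.
have -> : (Defs.move (x + d, 0) s).1 = (Defs.move (x, 0) s).1 + d.
  by case: s => //=; lia.
by rewrite IH PoszD mulrDl; case: (up && _) => /=; lia.
Qed.

(** From abscissa 0 a [SW] step may lead to -1, but the next peak needs another [NE] step first,
    which moves right; hence the bound -1 when [up] is false. *)
Lemma major_from_ge0 k up y x p :
  walk k up y p -> (if up then 0 else - 1) <= x -> 0 <= major_from up x p.
Proof.
elim: p up y x => [//|s p IH] up y x w x0.
have [z wz] : exists z, walk k (s == NE) z p.
  by case: s w => /= => [/andP[_]|/andP[_]|/and3P[_ _]|/and3P[_ _]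
    |/and3P[_ _]|/and3P[_ _]] w; eexists; exact: w.
rewrite /=; apply: addr_ge0; first by case: up x0 {w} => //=; case: ifP.
by apply: (IH _ z) => //; case: s w {wz} => /=; case: up x0 => //=; lia.
Qed.

(** * Splitting off the first step *)

(** The major index [n] is an integer so that the shift caused by a first step can be subtracted
    freely. *)
Definition walks k up y N (n : int) : set (seq step) :=
  [set p | [/\ walk k up y p, peak_count up p = N & major_from up 0 p = n]].

Lemma walks_lt0 k up y N n : n < 0 -> walks k up y N n = set0.
Proof.
move=> n0; apply/seteqP; split=> // p [w _ mn].
have : 0 <= major_from up 0 p by apply: (major_from_ge0 w); case: (up).
by rewrite mn; lia.
Qed.

Lemma walks_true_top k N n : (0 < k)%N -> walks k true k N n = set0.
Proof.
move=> k0; apply/seteqP; split=> // -[|s p] [] /=; first lia.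
by case: s => //=; lia.
Qed.

Lemma walks_true0 k y n : walks k true y.+1 0 n = set0.
Proof. by apply/seteqP; split=> // p [/walk_up_peak] + + _; lia. Qed.

(** [NE] and [E] force a peak, while South and [SW] steps require a preceding [NE]; only [SE]
    remains. *)
Lemma walk_false0 k y p :
  walk k false y p -> peak_count false p = 0%N -> p = nseq y SE.
Proof.
elim: p y => [|[] p IH] y /=; rewrite ?add0n //.
- by move=> /eqP ->.
- by move=> /andP[_ /walk_up_peak +] p0; rewrite [peak_count _ _]p0.
- by case: y => // y /andP[_ /IH pE] /pE ->.
- by move=> /and3P[_ + _] p0; rewrite [peak_count _ _]p0.
Qed.

Lemma walk_nseq k y : (y < k)%N -> walk k false y (nseq y SE).
Proof. by elim: y => //= y IH yk; rewrite yk IH // ltnW. Qed.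

Lemma nseq_SE_stats (F : fieldType) (a b : F) y :
  [/\ peak_count false (nseq y SE) = 0%N,
      forall x, major_from false x (nseq y SE) = 0 &
      weight a b false (nseq y SE) = 1].
Proof.
elim: y => // y [pc mj wt]; split=> [//|x|] /=.
  by rewrite mj addr0.
by rewrite wt mul1r.
Qed.

Lemma walks_false0 k y n : (y < k)%N ->
  walks k false y 0 n = if n == 0 then [set nseq y SE] else set0.
Proof.
move=> yk; have [pc mj _] := nseq_SE_stats (0 : rat) 0 y.
case: eqP => [->|n0]; apply/seteqP; split=> // p.
- by case=> w p0 _; rewrite /= (walk_false0 w p0).
- by move=> ->; split=> //; exact: walk_nseq.
- by case=> w p0 /=; rewrite (walk_false0 w p0) mj => /esym.
Qed.

Definition slice (A : set (seq step)) (s : step) : set (seq step) :=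
  [set p | A (s :: p)].

Lemma slicesE (A : set (seq step)) : ~ A [::] ->
  A = cons NE @` slice A NE `|` (cons SE @` slice A SE `|`
     (cons Sa @` slice A Sa `|` (cons Sb @` slice A Sb `|`
     (cons SW @` slice A SW `|` cons E @` slice A E)))).
Proof.
move=> A0; apply/seteqP; split=> [[//|s p] Ap|p]; last first.
  by case=> [|[|[|[|[]]]]] [r ? <-].
case: s Ap => Ap; [left|right;left|right;right;left|right;right;right;left|
  right;right;right;right;left|right;right;right;right;right]; by exists p.
Qed.

Lemma finite_slices (A : set (seq step)) : ~ A [::] ->
  (forall s, finite_set (slice A s)) -> finite_set A.
Proof.
move=> A0 Af; rewrite (slicesE A0).
by do 5!(rewrite finite_setU; split; first exact: finite_image);
  exact: finite_image.
Qed.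

Lemma fsum_consU (F : fieldType) (f : seq step -> F) s (A B : set (seq step)) :
  finite_set A -> finite_set B -> (forall p, ~ B (s :: p)) ->
  \sum_(p \in cons s @` A `|` B) f p =
  \sum_(p \in A) f (s :: p) + \sum_(p \in B) f p.
Proof.
move=> Af Bf sB; rewrite fsbigU0 //=.
- by rewrite fsbig_image // => p r _ _ [].
- exact: finite_image.
- by move=> _ [[p _ <-]] /sB.
Qed.

Lemma fsum_slices (F : fieldType) (f : seq step -> F) (A : set (seq step)) :
  ~ A [::] -> (forall s, finite_set (slice A s)) ->
  \sum_(p \in A) f p =
  \sum_(s <- [:: NE; SE; Sa; Sb; SW; E]) \sum_(p \in slice A s) f (s :: p).
Proof.
move=> A0 Af; rewrite [in LHS](slicesE A0) !big_cons big_nil addr0.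
have fin s : finite_set (cons s @` slice A s) by apply: finite_image.
rewrite fsum_consU //; first congr (_ + _).
rewrite fsum_consU //; first congr (_ + _).
rewrite fsum_consU //; first congr (_ + _).
rewrite fsum_consU //; first congr (_ + _).
rewrite fsum_consU //; first congr (_ + _).
by rewrite fsbig_image // => p r _ _ [].
all: rewrite ?finite_setU //.
all: by move=> p H; repeat destruct H as [H|H]; case: H.
Qed.

Lemma eq_NE : ((NE == NE) = true) * ((SE == NE) = false) * ((Sa == NE) = false) *
  ((Sb == NE) = false) * ((SW == NE) = false) * ((E == NE) = false).
Proof. by []. Qed.

Lemma walks_cons k up y N n s p :
  walks k up y N n (s :: p) <->
  [/\ walk k up y (s :: p), ((up && descends s) + peak_count (s == NE) p)%N = N &
      major_from (s == NE) 0 p +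
      (peak_count (s == NE) p)%:Z * (Defs.move (0, 0) s).1 = n].
Proof.
rewrite /walks -major_from_shift add0r.
by split=> -[w c m]; split=> //; move: m; rewrite /= if_same add0r.
Qed.

Lemma slice_NE k up y N n : (y < k)%N ->
  slice (walks k up y N n) NE = walks k true y.+1 N (n - N%:Z).
Proof.
move=> yk; apply/seteqP; split=> p.
  by move=> /walks_cons[/=]; rewrite yk andbF !eq_NE /= => w c m; split=> //; lia.
by case=> w c m; apply/walks_cons; split; rewrite /= ?eq_NE ?yk ?andbF //=; lia.
Qed.

(** The form [up + N] covers both cases: if [up] holds, the first vertex is a peak, which counts but
    lies at abscissa 0 and adds nothing to the major index. *)
Lemma slice_SE k up y N n : (y.+1 < k)%N ->
  slice (walks k up y.+1 (up + N) n) SE = walks k false y N (n - N%:Z).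
Proof.
move=> yk; apply/seteqP; split=> p.
  move=> /walks_cons[/=]; rewrite yk andbT !eq_NE /= => w c m.
  by split=> //; lia.
by case=> w c m; apply/walks_cons; split; rewrite /= ?eq_NE ?yk ?andbT //=; lia.
Qed.

Lemma slice_Sab k y N n s : s \in [:: Sa; Sb] -> (y.+1 < k)%N ->
  slice (walks k true y.+1 N.+1 n) s = walks k false y N n.
Proof.
move=> sS yk; apply/seteqP; split=> p.
  move=> /walks_cons[]; case: s sS => //= _; rewrite yk !eq_NE /= => w c m.
    by split=> //; lia.
  by split=> //; lia.
case=> w c m; apply/walks_cons.
by case: s sS => //= _; rewrite yk !eq_NE /=; split=> //; lia.
Qed.

Lemma slice_SW k y N n : (y.+1 < k)%N ->
  slice (walks k true y.+1 N.+1 n) SW = walks k false y N (n + N%:Z).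
Proof.
move=> yk; apply/seteqP; split=> p.
  by move=> /walks_cons[/=]; rewrite yk !eq_NE /= => w c m; split=> //; lia.
by case=> w c m; apply/walks_cons; split; rewrite /= ?eq_NE ?yk //=; lia.
Qed.

Lemma slice_S_false k y N n s : s \in [:: Sa; Sb; SW] ->
  slice (walks k false y N n) s = set0.
Proof.
by move=> sS; apply/seteqP; split=> // p []; case: s sS.
Qed.

(** With [N.+1] peaks, the later peak required by [E] is guaranteed. *)
Lemma slice_E k N n :
  slice (walks k false 0 N.+1 n) E = walks k false 0 N.+1 (n - N.+1%:Z).
Proof.
apply/seteqP; split=> p.
  by move=> /walks_cons[/= /andP[_ w]]; rewrite !eq_NE => c m; split=> //; lia.
by case=> w c m; apply/walks_cons; split; rewrite /= ?eq_NE ?c //=; lia.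
Qed.

Lemma slice_E_pos k up y N n : slice (walks k up y.+1 N n) E = set0.
Proof. by apply/seteqP; split=> // p []. Qed.

Lemma slice_SE0 k up N n : slice (walks k up 0 N n) SE = set0.
Proof. by apply/seteqP; split=> // p []. Qed.

Lemma walks_nil_true k y N n : ~ walks k true y.+1 N n [::].
Proof. by case. Qed.

Lemma walks_nil_false k y N n : ~ walks k false y N.+1 n [::].
Proof. by case. Qed.

Lemma finite_slices_true k y N n : (y.+1 < k)%N ->
  (forall n, finite_set (walks k false y N n)) ->
  (forall n, finite_set (walks k true y.+2 N.+1 n)) ->
  forall s, finite_set (slice (walks k true y.+1 N.+1 n) s).
Proof.
move=> yk Ff Ft; case.
- by rewrite slice_NE.
- by rewrite (slice_SE true N).
- by rewrite slice_Sab.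
- by rewrite slice_Sab.
- by rewrite slice_SW.
- by rewrite slice_E_pos.
Qed.

Lemma finite_slices_false k y N n : (y.+1 < k)%N ->
  (forall n, finite_set (walks k false y N n)) ->
  (forall n, finite_set (walks k true y.+2 N n)) ->
  forall s, finite_set (slice (walks k false y.+1 N n) s).
Proof.
move=> yk Ff Ft; case.
- by rewrite slice_NE.
- by rewrite (slice_SE false N).
- by rewrite slice_S_false.
- by rewrite slice_S_false.
- by rewrite slice_S_false.
- by rewrite slice_E_pos.
Qed.

Lemma finite_slices_false0 k N n : (0 < k)%N ->
  finite_set (walks k false 0 N.+1 (n - N.+1%:Z)) ->
  (forall n, finite_set (walks k true 1 N.+1 n)) ->
  forall s, finite_set (slice (walks k false 0 N.+1 n) s).
Proof.
move=> k0 Ff Ft; case.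
- by rewrite slice_NE.
- by rewrite slice_SE0.
- by rewrite slice_S_false.
- by rewrite slice_S_false.
- by rewrite slice_S_false.
- by rewrite slice_E.
Qed.

(** Induction on [N]. After an [NE] step, a descent uses up a peak and another [NE] approaches the
    forbidden height [k]. Otherwise the height is the measure: [SE] lowers it and [NE] leads to the
    first case. *)
Lemma finite_walks k N : (0 < k)%N ->
  (forall y n, (y < k)%N -> finite_set (walks k false y N n)) /\
  (forall y n, (y < k)%N -> finite_set (walks k true y.+1 N n)).
Proof.
move=> k0; elim: N => [|N [IHf _]].
  split=> y n yk; last by rewrite walks_true0.
  by rewrite walks_false0 //; case: ifP.
have Ft y n : (y < k)%N -> finite_set (walks k true y.+1 N.+1 n).
  move=> yk; have [m] := ubnP (k - y)%N; elim: m y yk n => // m IH y yk n ym.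
  have [yk1|] := ltnP y.+1 k; last first.
    by move=> ky; rewrite (_ : y.+1 = k) ?walks_true_top //; lia.
  apply: finite_slices; first exact: walks_nil_true.
  by apply: finite_slices_true => // n'; [apply: IHf; lia|apply: IH; lia].
split=> // y n yk.
elim: y yk n => [|y IH] yk n.
  (* On the axis [E] keeps the height and the peaks but lowers [n] by [N.+1], and no walk has
     negative [n]; so a bound on [n] serves as measure. *)
  have [m] : exists m : nat, n < m%:Z by exists `|n|%N.+1; lia.
  elim: m n => [|m IH] n nm; first by rewrite walks_lt0.
  apply: finite_slices; first exact: walks_nil_false.
  by apply: finite_slices_false0 => // [|n']; [apply: IH; lia|apply: Ft].
apply: finite_slices; first exact: walks_nil_false.
by apply: finite_slices_false => // n'; [apply: IH; lia|apply: Ft].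
Qed.

(** * Recurrences for the generating functions *)

(* Extending the coefficients by 0 to negative exponents turns multiplication
   by a power of X into a plain shift. *)
Definition zcoef (F : fieldType) (f : fps F) (n : int) : F :=
  if n is Posz m then f m else 0.

Lemma zcoefP (F : fieldType) (f g : fps F) : zcoef f =1 zcoef g -> f = g.
Proof. by move=> fg; apply: fpsP => n; exact: (fg n). Qed.

Lemma zcoefD (F : fieldType) (f g : fps F) n :
  zcoef (f + g) n = zcoef f n + zcoef g n.
Proof. by case: n => //= _; rewrite addr0. Qed.

Lemma zcoefC (F : fieldType) (c : F) f n : zcoef (fpsC c * f) n = c * zcoef f n.
Proof.
case: n => n /=; last by rewrite mulr0.
by rewrite big_ord_recl /= subn0 big1 ?addr0 // => i _; rewrite mul0r.
Qed.

Lemma zcoefX (F : fieldType) (f : fps F) n : zcoef (fpsX F * f) n = zcoef f (n - 1).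
Proof.
case: n => [[|n]|n] //; first by rewrite /= big_ord1 mul0r.
rewrite (_ : n.+1%:Z - 1 = n%:Z) /=; last lia.
rewrite big_ord_recl mul0r add0r big_ord_recl mul1r subSS subn0 big1 ?addr0 //.
by move=> i _; rewrite mul0r.
Qed.

Lemma zcoefXn (F : fieldType) (f : fps F) m n :
  zcoef (fpsX F ^+ m * f) n = zcoef f (n - m%:Z).
Proof.
elim: m n => [|m IH] n; first by rewrite expr0 mul1r subr0.
by rewrite exprS -mulrA zcoefX IH; congr zcoef; lia.
Qed.

Definition walk_series (F : fieldType) (a b : F) k up y N : fps F :=
  Fps (fun n => \sum_(p \in walks k up y N n%:Z) weight a b up p).

Lemma zcoef_walk_series (F : fieldType) (a b : F) k up y N n :
  zcoef (walk_series a b k up y N) n =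
  \sum_(p \in walks k up y N n) weight a b up p.
Proof. by case: n => //= n; rewrite walks_lt0 // fsbig_set0. Qed.

Lemma genfun_walk_series (F : fieldType) (a b : F) k prev v y N P :
  v.1 = 0 ->
  (forall p, P p <->
     walk k (prev == Some NE) y p /\ peak_count (prev == Some NE) p = N) ->
  genfun a b prev v P = walk_series a b k (prev == Some NE) y N.
Proof.
move=> v0 PE; apply: fpsP => n /=.
under eq_fsbigr do rewrite marks_weight.
apply: eq_fsbigl; apply/seteqP; split=> p /=.
  by case=> /PE[w c]; rewrite major_fromE v0 => m.
by case=> w c m; split; [exact/PE|rewrite major_fromE v0].
Qed.

Lemma Epaths_series (F : fieldType) (a b : F) k i N : (0 < k)%N -> (i <= k)%N ->
  Epaths a b k i N = walk_series a b k false (k - i) N.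
Proof.
move=> k0 ik; apply: (@genfun_walk_series F a b k None) => // p.
exact: odd_pathsE.
Qed.

Lemma Gpaths_series (F : fieldType) (a b : F) k i N : (i < k)%N ->
  Gpaths a b k i N = walk_series a b k true (k - i) N.
Proof.
move=> ik; have k0 : (0 < k)%N by lia.
apply: (@genfun_walk_series F a b k (Some NE)) => // p /=.
rewrite odd_pathsE //= (_ : (k - i = (k - i.+1).+1)%N); last lia.
by rewrite (_ : (k - i.+1 < k)%N = true) //=; lia.
Qed.

Lemma series_up_top (F : fieldType) (a b : F) k N : (0 < k)%N ->
  walk_series a b k true k N = 0.
Proof.
move=> k0; apply: fpsP => n /=.
by rewrite walks_true_top // fsbig_set0; case: n.
Qed.

Lemma series_up0 (F : fieldType) (a b : F) k y :
  walk_series a b k true y.+1 0 = 0.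
Proof. by apply: fpsP => n /=; rewrite walks_true0 fsbig_set0; case: n. Qed.

Lemma series0 (F : fieldType) (a b : F) k y : (y < k)%N ->
  walk_series a b k false y 0 = 1.
Proof.
move=> yk; apply: fpsP => n /=; rewrite walks_false0 //.
have [_ _ wt] := nseq_SE_stats a b y.
by case: n => [|n] /=; rewrite ?fsbig_set1 ?fsbig_set0.
Qed.

Lemma series_down (F : fieldType) (a b : F) k y N : (y.+1 < k)%N ->
  walk_series a b k false y.+1 N.+1 =
  fpsX F ^+ N.+1 *
  (walk_series a b k true y.+2 N.+1 + walk_series a b k false y N.+1).
Proof.
move=> yk; have [Ff Ft] := @finite_walks k N.+1 ltac:(lia).
apply: zcoefP => n; rewrite zcoefXn zcoefD !zcoef_walk_series.
rewrite fsum_slices; last 2 first.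
- exact: walks_nil_false.
- by apply: finite_slices_false => // n'; [apply: Ff; lia|apply: Ft].
rewrite !big_cons big_nil slice_E_pos slice_NE //.
rewrite (slice_SE false N.+1) // !slice_S_false //.
rewrite !fsbig_set0 !addr0 /=.
by congr (_ + _); apply: eq_fsbigr => p _; rewrite mul1r.
Qed.

Lemma series_axis (F : fieldType) (a b : F) k N : (0 < k)%N ->
  walk_series a b k false 0 N.+1 =
  fpsX F ^+ N.+1 *
  (walk_series a b k true 1 N.+1 + walk_series a b k false 0 N.+1).
Proof.
move=> k0; have [Ff Ft] := @finite_walks k N.+1 k0.
apply: zcoefP => n; rewrite zcoefXn zcoefD !zcoef_walk_series.
rewrite fsum_slices; last 2 first.
- exact: walks_nil_false.
- by apply: finite_slices_false0 => // *; [apply: Ff; lia|apply: Ft].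
rewrite !big_cons big_nil slice_NE // slice_SE0 slice_E.
rewrite !slice_S_false // !fsbig_set0 !add0r addr0 /=.
by congr (_ + _); apply: eq_fsbigr => p _; rewrite mul1r.
Qed.

(** The steps [SE], [Sa], [Sb], [SW] shift the other [N] peaks by 1, 0, 0, -1, giving q^N + a + b +
    ab q^(-N). Multiplying by q^N clears the negative power and makes this factor. *)
Lemma series_up (F : fieldType) (a b : F) k y N : (y.+1 < k)%N ->
  fpsX F ^+ N * walk_series a b k true y.+1 N.+1 =
  fpsX F ^+ (N + N.+1) * walk_series a b k true y.+2 N.+1 +
  (fpsC a + fpsX F ^+ N) * (fpsC b + fpsX F ^+ N) * walk_series a b k false y N.
Proof.
move=> yk; have [_ Ft] := @finite_walks k N.+1 ltac:(lia).
have [Ff _] := @finite_walks k N ltac:(lia).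
set U := walk_series _ _ _ _ _ _; set V := walk_series _ _ _ _ _ _.
set W := walk_series _ _ _ _ _ _.
have -> : (fpsC a + fpsX F ^+ N) * (fpsC b + fpsX F ^+ N) * W =
    fpsC a * (fpsC b * W) + (fpsX F ^+ N * (fpsC a * W) +
    (fpsX F ^+ N * (fpsC b * W) + fpsX F ^+ (N + N) * W)).
  by rewrite exprD; ring.
apply: zcoefP => n; rewrite !zcoefD !(zcoefXn, zcoefC) !zcoef_walk_series.
rewrite fsum_slices; last 2 first.
- exact: walks_nil_true.
- by apply: finite_slices_true => // n'; [apply: Ff; lia|apply: Ft].
rewrite !big_cons big_nil slice_NE //.
rewrite (slice_SE true N) // slice_SW // slice_E_pos !slice_Sab // !fsbig_set0 /=.
rewrite !mulr_fsumr.
rewrite (_ : n - N%:Z + N%:Z = n); last lia.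
rewrite (_ : n - N%:Z - N.+1%:Z = n - (N + N.+1)%N%:Z); last lia.
rewrite (_ : n - N%:Z - N%:Z = n - (N + N)%N%:Z); last lia.
under eq_fsbigr do rewrite mul1r.
under [X in _ + (X + _)]eq_fsbigr do rewrite mul1r.
under [X in _ = _ + (X + _)]eq_fsbigr do rewrite mulrA.
by ring.
Qed.

(** * The theta-like sums *)

Lemma mem_int_range lo hi n : (n \in int_range lo hi) = (lo <= n <= hi).
Proof.
rewrite /int_range; case: ifP => [lh|]; last by rewrite in_nil; lia.
apply/mapP/idP => [[j]|lnh]; first by rewrite mem_iota => jr ->; lia.
by exists (absz (n - lo)%R); [rewrite mem_iota|]; lia.
Qed.

Lemma int_range_uniq lo hi : uniq (int_range lo hi).
Proof.
rewrite /int_range; case: ifP => // _.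
by rewrite map_inj_uniq ?iota_uniq // => i j; lia.
Qed.

Lemma sum_int_range_widen (K : fieldType) (f : int -> K) lo hi lo' hi' :
  lo' <= lo -> hi <= hi' -> (forall n, ~~ (lo <= n <= hi) -> f n = 0) ->
  \sum_(n <- int_range lo hi) f n = \sum_(n <- int_range lo' hi') f n.
Proof.
move=> ll hh f0; rewrite -[RHS](big_rmcond (fun n => lo <= n <= hi)) //.
rewrite -[RHS]big_filter; apply/perm_big/uniq_perm.
- exact: int_range_uniq.
- by rewrite filter_uniq // int_range_uniq.
- by move=> n; rewrite mem_filter !mem_int_range; lia.
Qed.

Lemma sum_int_range_opp (K : fieldType) (f : int -> K) m :
  \sum_(n <- int_range (- m) m) f n = \sum_(n <- int_range (- m) m) f (- n).
Proof.
rewrite -[RHS](big_map -%R xpredT); apply/perm_big/uniq_perm.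
- exact: int_range_uniq.
- by rewrite map_inj_uniq ?int_range_uniq //; exact: oppr_inj.
move=> n; rewrite -[n in RHS]opprK mem_map; last exact: oppr_inj.
by rewrite !mem_int_range; lia.
Qed.

(* Cancelling the terms in pairs, and not just deducing S = -S from the
   reflection, keeps this valid in characteristic 2. *)
Lemma sum_int_range_antisym (K : fieldType) (f : int -> K) (N : nat) :
  (forall n, f (- 1 - n) = - f n) ->
  \sum_(n <- int_range (- N%:Z) (N%:Z - 1)) f n = 0.
Proof.
move=> fN.
have -> : \sum_(n <- int_range (- N%:Z) (N%:Z - 1)) f n =
    \sum_(n <- [seq j%:Z | j <- iota 0 N] ++ [seq - 1 - j%:Z | j <- iota 0 N]) f n.
  apply/perm_big/uniq_perm; first exact: int_range_uniq.
    rewrite cat_uniq !map_inj_uniq ?iota_uniq //=; try by move=> i j; lia.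
    by rewrite andbT; apply/hasPn => _ /mapP[j _ ->]; apply/mapP => -[i _]; lia.
  move=> n; rewrite mem_int_range mem_cat; apply/idP/orP => [nN|].
    have [n0|n0] := lerP 0 n; [left|right]; apply/mapP.
      by exists (absz n); rewrite ?mem_iota; lia.
    by exists (absz (- 1 - n)%R); rewrite ?mem_iota; lia.
  by case=> /mapP[j]; rewrite mem_iota => jN ->; lia.
rewrite big_cat /= !big_map -big_split /=.
by rewrite big1 // => j _; rewrite fN subrr.
Qed.

(* The value 0 for m < 0 makes the bounds of the summations immaterial. *)
Definition qpoch_recip (K : fieldType) (q : K) (m : int) : K :=
  if m is Posz n then (qpoch q q n)^-1 else 0.

(** At [m = 0] the factor [1 - q ^ m] vanishes and so matches the value 0 at -1: the relation
    persists at the edge of the support. *)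
Lemma qpoch_recip_pred (K : fieldType) (q : K) (m : int) :
  (forall n : nat, 1 - q ^+ n.+1 != 0) ->
  qpoch_recip q m * (1 - q ^ m) = qpoch_recip q (m - 1).
Proof.
move=> q1; case: m => [[|m]|m]; [by rewrite subrr mulr0| |by rewrite mul0r].
rewrite (_ : m.+1%:Z - 1 = m%:Z) /=; last lia.
by rewrite /qpoch big_ord_recr /= -exprS invfM mulfVK.
Qed.

Definition theta_exp (k : nat) (n : int) : int :=
  ((n * ((2%:Z * k%:Z - 1) * n + 3%:Z))%R %/ 2%:Z)%Z.

(** Either [n] is even, or (2k-1)n and 3 are both odd and their sum is even; the division in
    [theta_exp] is thus exact. *)
Lemma theta_expK k n :
  theta_exp k n * 2 = n * ((2%:Z * k%:Z - 1) * n + 3%:Z).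
Proof.
rewrite /theta_exp divzK //.
have [m [e|e]] : exists m : int, n = m * 2 \/ n = m * 2 + 1.
  by exists (n %/ 2)%Z; lia.
  apply/dvdzP; exists (m * ((2%:Z * k%:Z - 1) * n + 3%:Z)); rewrite e; ring.
apply/dvdzP; exists (n * ((2%:Z * k%:Z - 1) * m + k%:Z + 1)); rewrite e; ring.
Qed.

Lemma theta_exp_opp k n : theta_exp k (- n) = theta_exp k n - 3 * n.
Proof. by have := theta_expK k n; have := theta_expK k (- n); nia. Qed.

Lemma theta_exp_refl k n :
  theta_exp k (- 1 - n) = theta_exp k n + (k%:Z - 2) * (2 * n + 1).
Proof. by have := theta_expK k n; have := theta_expK k (- 1 - n); nia. Qed.

Definition theta_term (K : fieldType) (q : K) (k : nat) (c n : int) : K :=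
  (- 1) ^ n * q ^ (theta_exp k n + c * n).

(** This is the sum for [Epaths] at c = k-i-1; [theta_odd] is the sum for [Gpaths] at c = k-i-2. *)
Definition theta_even (K : fieldType) (q : K) k c (N : nat) : K :=
  \sum_(n <- int_range (- N%:Z) N%:Z)
    theta_term q k c n * (qpoch_recip q (N%:Z - n) * qpoch_recip q (N%:Z + n)).

Definition theta_odd (K : fieldType) (q : K) k c (N : nat) : K :=
  \sum_(n <- int_range (- N%:Z) (N%:Z - 1))
    theta_term q k c n * (qpoch_recip q (N%:Z - n - 1) * qpoch_recip q (N%:Z + n)).

Lemma theta_term_shift (K : fieldType) (q : K) k c d n : q != 0 ->
  theta_term q k (c + d) n = theta_term q k c n * q ^ (d * n).
Proof.
move=> q0; rewrite /theta_term -mulrA -expfzDr //.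
by congr (_ * q ^ _); ring.
Qed.

Lemma signz_opp (K : fieldType) (n : int) : (- 1 : K) ^ (- n) = (- 1) ^ n.
Proof. by rewrite -exprz_inv invrN1. Qed.

Lemma qpoch_recip_lt0 (K : fieldType) (q : K) m : m < 0 -> qpoch_recip q m = 0.
Proof. by case: m. Qed.

(** Split 1 = (1 - q^(N-n)) + q^N q^(-n): the first part lowers the index of (q;q)_(N-n), and q^(-n)
    lowers [c]. *)
Lemma theta_even_rec (K : fieldType) (q : K) k c N : q != 0 ->
  (forall n : nat, 1 - q ^+ n.+1 != 0) ->
  theta_even q k c N = theta_odd q k c N + q ^+ N * theta_even q k (c - 1) N.
Proof.
move=> q0 q1; rewrite /theta_odd (@sum_int_range_widen _ _ _ _ (- N%:Z) N%:Z) //.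
- rewrite mulr_sumr -big_split /=; apply: eq_bigr => n _.
  rewrite -(qpoch_recip_pred _ q1) theta_term_shift // mulN1r.
  by rewrite exprnP expfzDr //; ring.
- lia.
- move=> n nN; have [nN'|nN'] := ltrP (N%:Z + n) 0.
    by rewrite (qpoch_recip_lt0 _ nN') !mulr0.
  by rewrite (@qpoch_recip_lt0 _ _ (N%:Z - n - 1)) ?mul0r ?mulr0 //; lia.
Qed.

(** Split 1 = q^(N+1) q^n + (1 - q^(N+1+n)), now acting on the other denominator. *)
Lemma theta_odd_rec (K : fieldType) (q : K) k c N : q != 0 ->
  (forall n : nat, 1 - q ^+ n.+1 != 0) ->
  theta_odd q k c N.+1 = q ^+ N.+1 * theta_odd q k (c + 1) N.+1 + theta_even q k c N.
Proof.
move=> q0 q1; rewrite /theta_odd /theta_even.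
(* The term gained, at n = -N-1, vanishes because [N + n] is negative there. *)
rewrite [in RHS](@sum_int_range_widen _ _ (- N%:Z) N%:Z (- N.+1%:Z) (N.+1%:Z - 1)).
- rewrite mulr_sumr -big_split /=; apply: eq_bigr => n _.
  have -> : N%:Z + n = N.+1%:Z + n - 1 by lia.
  have -> : N.+1%:Z - n - 1 = N%:Z - n by lia.
  rewrite -(qpoch_recip_pred _ q1) theta_term_shift // mul1r.
  by rewrite exprnP expfzDr //; ring.
- lia.
- lia.
- move=> n nN; have [nN'|nN'] := ltrP (N%:Z + n) 0.
    by rewrite (qpoch_recip_lt0 _ nN') !mulr0.
  by rewrite (@qpoch_recip_lt0 _ _ (N%:Z - n)) ?mul0r ?mulr0 //; lia.
Qed.

(** Under n -> -n the two reciprocals trade places and [theta_exp] drops by 3n, so the linear term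
    -2n becomes 2n - 3n = -n. *)
Lemma theta_even_sym (K : fieldType) (q : K) k N :
  theta_even q k (- 2) N = theta_even q k (- 1) N.
Proof.
rewrite /theta_even sum_int_range_opp; apply: eq_bigr => n _.
rewrite /theta_term signz_opp theta_exp_opp opprK.
rewrite [qpoch_recip q _ * qpoch_recip q _]mulrC.
by congr (_ * q ^ _ * _); lia.
Qed.

(** Under n -> -1-n the exponent for c = k-2 is unchanged, the reciprocals trade places and the sign
    flips: the terms cancel in pairs. *)
Lemma theta_odd_top (K : fieldType) (q : K) k N : theta_odd q k (k%:Z - 2) N = 0.
Proof.
apply: sum_int_range_antisym => n; rewrite /theta_term theta_exp_refl.
rewrite [(- 1) ^ _]expfzDr ?oppr_eq0 ?oner_eq0 // exprN1 invrN1 signz_opp mulN1r.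
rewrite !mulNr; congr (- (_ * q ^ _ * _)); first by ring.
by rewrite mulrC; congr (qpoch_recip _ _ * qpoch_recip _ _); lia.
Qed.

Lemma theta_odd0 (K : fieldType) (q : K) k c : theta_odd q k c 0 = 0.
Proof. by rewrite /theta_odd /int_range big_nil. Qed.

Lemma theta_even0 (K : fieldType) (q : K) k c : theta_even q k c 0 = 1.
Proof.
rewrite /theta_even (_ : int_range _ _ = [:: 0]) // big_seq1 /theta_term.
by rewrite /theta_exp !mul0r mulr0 addr0 /= /qpoch big_ord0 invr1 !mulr1.
Qed.

(** * Solving the recurrences in the fraction field *)

Lemma qpoch2_prod (K : fieldType) (a b q : K) N : a != 0 -> b != 0 ->
  (a * b) ^+ N * qpoch2 (- 1 / a) (- 1 / b) q N =
  \prod_(j < N) ((a + q ^+ j) * (b + q ^+ j)).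
Proof.
move=> a0 b0; rewrite /qpoch2 /qpoch -big_split -{1}(card_ord N) -prodr_const.
rewrite -big_split; apply: eq_bigr => j _ /=.
(* Factor by factor, a(1 + q^j/a) = a + q^j, and likewise for [b]. *)
by field; rewrite a0 b0.
Qed.

(** The order is that of [finite_walks]: induction on [N], then the series after [NE] from the top
    downwards, then the others from the axis upwards. *)
Lemma tofrac_walk_series (F : fieldType) (a b : F) (k N : nat) :
  let q : laurent F := laurentX F in
  let C := \prod_(j < N) ((laurentC a + q ^+ j) * (laurentC b + q ^+ j)) in
  (0 < k)%N ->
  (forall y : nat, (y < k)%N ->
     tofrac (walk_series a b k false y N) =
     C * q ^+ N * theta_even q k (y%:Z - 1) N) /\
  (forall y : nat, (y < k)%N ->
     tofrac (walk_series a b k true y.+1 N) = C * theta_odd q k (y%:Z - 1) N).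
Proof.
move=> q /= k0.
have X0 : fpsX F != 0.
  by apply/eqP => /(congr1 (fun f : fps F => f 1%N)) /= /eqP; rewrite oner_eq0.
have q0 : q != 0 by rewrite tofrac_eq0.
have q1 n : 1 - q ^+ n.+1 != 0.
  rewrite subr_eq0 eq_sym -tofracXn -tofrac1 tofrac_eq; apply/eqP => e.
  (* If q^(n+1) were 1, the constant terms 0 and 1 would agree. *)
  have : zcoef (fpsX F ^+ n.+1 * 1) 0 = zcoef 1 0 by rewrite mulr1 e.
  by rewrite zcoefXn /= => /esym/eqP; rewrite oner_eq0.
elim: N => [|N [IHf _]].
  split=> y yk; rewrite big_ord0.
    by rewrite series0 // tofrac1 theta_even0 !mulr1.
  by rewrite series_up0 tofrac0 theta_odd0 mulr0.
set C := \prod_(j < N.+1) _.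
have Ft y : (y < k)%N ->
    tofrac (walk_series a b k true y.+1 N.+1) = C * theta_odd q k (y%:Z - 1) N.+1.
  move=> yk; have [m] := ubnP (k - y)%N; elim: m y yk => // m IH y yk ym.
  have [yk1|] := ltnP y.+1 k; last first.
    move=> ky; have ek : y.+1 = k by lia.
    rewrite ek series_up_top // tofrac0 (_ : y%:Z - 1 = k%:Z - 2); last lia.
    by rewrite theta_odd_top mulr0.
  have := congr1 (fun f => tofrac f) (series_up a b N yk1).
  rewrite !(tofracD, tofracM, tofracXn) -[tofrac (fpsX F)]/q IHf; last lia.
  rewrite (IH y.+1) //; last lia.
  rewrite (theta_odd_rec k (y%:Z - 1) N q0 q1) (_ : y.+1%:Z - 1 = y%:Z - 1 + 1); last lia.
  (* The last factor of [C] is the product over the four kinds of peak in [series_up]; the common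
     power [q ^ N] then cancels. *)
  rewrite /C big_ord_recr /= => e; apply: (mulfI (expf_neq0 N q0)); rewrite e.
  by rewrite !exprD -/(laurentC a) -/(laurentC b); ring.
split=> // y yk; elim: y yk => [|y IH] yk.
  have := congr1 (fun f => tofrac f) (series_axis a b N k0).
  rewrite !(tofracD, tofracM, tofracXn) -[tofrac (fpsX F)]/q Ft // => e.
  (* The unknown series stands on both sides of the axis recurrence; multiplying by the nonzero 1 -
     q^(N+1) isolates it. *)
  apply: (mulIf (q1 N)); rewrite mulrBr mulr1 {1}e.
  rewrite mulrDr [X in _ + X - _]mulrC addrK sub0r.
  (* The symmetry between c = -2 and c = -1 puts the same sum on both sides here too. *)
  have := theta_even_rec k (- 1) N.+1 q0 q1.
  rewrite -opprD -[1 + 1]/2 theta_even_sym => e1.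
  by rewrite -mulrA mulrBr mulr1 {1}e1; ring.
have := congr1 (fun f => tofrac f) (series_down a b N yk).
rewrite !(tofracD, tofracM, tofracXn) -[tofrac (fpsX F)]/q Ft // IH => [->|]; last lia.
rewrite (theta_even_rec k (y.+1%:Z - 1) N.+1 q0 q1) (_ : y.+1%:Z - 1 - 1 = y%:Z - 1); last lia.
by ring.
Qed.

Theorem theorem5 (F : fieldType) (a b : F) (ha : a != 0) (hb : b != 0)
    (k : nat) (hk : (2 <= k)%N) :
  let A : laurent F := laurentC a in
  let B : laurent F := laurentC b in
  let q : laurent F := laurentX F in
  (forall i N : nat, (0 < i <= k)%N ->
    tofrac (Epaths a b k i N) =
    (A * B) ^+ N * qpoch2 (- 1 / A) (- 1 / B) q N * q ^+ N *
    \sum_(n <- int_range (- N%:Z) N%:Z)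
      (- 1) ^ n *
      q ^ (((n * ((2%:Z * k%:Z - 1) * n + 3%:Z))%R %/ 2%:Z)%Z
           + (k%:Z - i%:Z - 1) * n) /
      (qpoch q q (absz (N%:Z - n)%R) * qpoch q q (absz (N%:Z + n)%R))) /\
  (forall i N : nat, (i < k)%N ->
    tofrac (Gpaths a b k i N) =
    (A * B) ^+ N * qpoch2 (- 1 / A) (- 1 / B) q N *
    \sum_(n <- int_range (- N%:Z) (N%:Z - 1))
      (- 1) ^ n *
      q ^ (((n * ((2%:Z * k%:Z - 1) * n + 3%:Z))%R %/ 2%:Z)%Z
           + (k%:Z - i%:Z - 2%:Z) * n) /
      (qpoch q q (absz (N%:Z - n - 1)%R) * qpoch q q (absz (N%:Z + n)%R))).
Proof.
move=> A B q; have k0 : (0 < k)%N by lia.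
have C0 (c : F) : c != 0 -> laurentC c != 0.
  move=> c0; rewrite tofrac_eq0; apply: contra c0 => /eqP.
  by move/(congr1 (fun f : fps F => f 0%N)) => /= ->.
(* Within the summation ranges all indices are nonnegative, where [qpoch_recip] is the reciprocal in
   the statement. *)
have recipE m : 0 <= m -> (qpoch q q (absz m))^-1 = qpoch_recip q m by case: m.
split=> i N ik.
  rewrite Epaths_series //; last lia.
  have [evenE _] := tofrac_walk_series a b N k0; rewrite evenE; last lia.
  rewrite qpoch2_prod ?C0 // (_ : (k - i)%N%:Z = k%:Z - i%:Z); last lia.
  congr (_ * _); apply: eq_big_seq => n; rewrite mem_int_range => nN.
  by rewrite invfM !recipE //; lia.
(* The height [k - i] is the successor of y = k-i-1, whence c = y-1 = k-i-2. *)
rewrite Gpaths_series // (_ : (k - i)%N = (k - i.+1).+1); last lia.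
have [_ oddE] := tofrac_walk_series a b N k0; rewrite oddE; last lia.
rewrite qpoch2_prod ?C0 // (_ : (k - i.+1)%N%:Z - 1 = k%:Z - i%:Z - 2); last lia.
congr (_ * _); apply: eq_big_seq => n; rewrite mem_int_range => nN.
by rewrite invfM !recipE //; lia.
Qed.
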